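(* Let $S$ be a standard graded algebra over a field $k$. Suppose that $I\subset S$ is an ideal generated by forms of a single degree $d$, and $M$ is a finitely generated graded $S$-module, generated in a single degree, such that $M/IM$ has finite length. Let $e$ be the number such that $\operatorname{reg} I^mM=md+e$ for $m\gg0$. Then the equality $$\operatorname{reg} I^mM=md+e$$ holds for all $$m\ \ge\ \max\left\{\operatorname{reg}_y \mathcal R(I,M),\ \frac{\operatorname{reg} M+1}{d}\right\}.$$
   Context: A standard graded algebra over a field $k$ is a graded $k$-algebra $S=\bigoplus_{j\ge 0}S_j$ with $S_0=k$ generated by finitely many forms of degree one. For an artinian graded module $H$, $\operatorname{reg} H=\max\{j\mid H_j\ne 0\}$ (with $\operatorname{reg} 0=-\infty$). For a finitely generated graded module $M$ over a standard graded algebra $S$ with homogeneous maximal ideal $S_+$, $\operatorname{reg} M=\max_i\{\operatorname{reg} H^i_{S_+}(M)+i\}$ is the Castelnuovo-Mumford regularity. It is known that in the situation of the claim the difference $\operatorname{reg} I^mM-md$ is eventually constant in $m$ (as long as $I^mM\neq 0$ for all $m$); $e$ denotes this constant value. With $t$ an indeterminate, the Rees algebra is $\mathcal R(I)=S[It]=\bigoplus_{n\ge0}I^nt^n\subset S[t]$, and the Rees module is $\mathcal R(I,M)=S[It]M=\bigoplus_{n\ge 0}I^nM\,t^n\subset M\otimes_SS[t]$. Let $I_d$ be the degree $d$ part of $I$. These objects are bigraded by giving the linear forms of $S$ bidegree $(1,0)$ and the elements of $I_dt$ bidegree $(0,1)$; thus $(I^nM)_{nd+i}t^n$ has bidegree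 $(i,n)$. The $(0,1)$-regularity $\operatorname{reg}_y\mathcal R(I,M)$ is the Castelnuovo-Mumford regularity of $\mathcal R(I,M)$ with respect to the second grading: it is the maximum of $n+j$ such that the local cohomology module $H^j_{(I_dt)}(\mathcal R(I,M))$ has a nonzero component in some bidegree $( *,n)$. Equivalently, it is the maximum over $i$ of the Castelnuovo-Mumford regularities of the modules $N_i(I,M)=\bigoplus_{n\ge0}(I_d)^nM_i\,t^n$ over the standard graded $k$-algebra $A=k[I_dt]$, all graded by the power of $t$.
   Formalization: M is assumed generated in a single degree q ≥ 0 (and d ≥ 1); for q < 0 the claim fails, e.g. S = k[l,z,w]/(lz,lw,z²,w²), I = (l,w), M = S(3), m = 1, where reg IM = −1 but md+e = −2. *)

(* Defs.v *)
From HB Require Import structures.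
From mathcomp Require Import all_boot all_order all_algebra.
From mathcomp Require Import boolp classical_sets functions constructive_ereal.

Set Implicit Arguments.
Unset Strict Implicit.
Unset Printing Implicit Defensive.

Import Order.TTheory GRing.Theory Num.Theory.
Local Open Scope classical_set_scope.
Local Open Scope ring_scope.

Definition direct_sum_decomposition (J : choiceType) (V : zmodType)
    (W : J -> set V) : Prop :=
  [/\ forall j, W j 0 /\ (forall u v, W j u -> W j v -> W j (u - v)),
      forall v, exists (s : seq J) (c : J -> V),
        (forall j, W j (c j)) /\ v = \sum_(j <- s) c j
    & forall (s : seq J) (c : J -> V), uniq s -> (forall j, W j (c j)) ->
        \sum_(j <- s) c j = 0 -> forall j, j \in s -> c j = 0].

(* The family x is a chosen finite set of algebra generators of degree one;
   in particular it generates the ideal S_+. *)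
Definition standard_graded (k : fieldType) (S : comAlgType k)
    (Sg : nat -> set S) (r : nat) (x : 'I_r -> S) : Prop :=
  [/\ direct_sum_decomposition Sg,
      forall i j a b, Sg i a -> Sg j b -> Sg (i + j)%N (a * b),
      Sg 0%N = range (fun c : k => c%:A),
      forall i, Sg 1%N (x i)
    & forall P : {pred S}, GRing.subalg_closed P -> (forall i, x i \in P) ->
        forall a, a \in P].

Definition graded_module (S : comNzRingType) (Sg : nat -> set S)
    (M : lmodType S) (Mg : int -> set M) : Prop :=
  direct_sum_decomposition Mg /\
  (forall i j a u, Sg i a -> Mg j u -> Mg (i%:Z + j) (a *: u)).

Section Submodules.
Variables (S : comNzRingType) (M : lmodType S).
Implicit Types (N X : set M) (I : set S).

Definition mspan X : set M :=
  [set v | exists n (a : 'I_n -> S) (u : 'I_n -> M),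
     (forall i, X (u i)) /\ v = \sum_i a i *: u i].

Definition submodule N : Prop :=
  N 0 /\ (forall a u v, N u -> N v -> N (a *: u + v)).

Definition finitely_generated : Prop :=
  exists n (u : 'I_n -> M), mspan (range u) = setT.

(* Submodules of M/N are the submodules of M containing N, and the length is
   the supremum of the lengths of their strict chains. *)
Definition finite_length_quotient N : Prop :=
  exists l : nat, forall (n : nat) (C : nat -> set M),
    (forall i, (i <= n)%N -> submodule (C i) /\ N `<=` C i) ->
    (forall i, (i < n)%N -> C i `<` C i.+1) ->
    (n <= l)%N.

Definition ideal_mul I N : set M := mspan [set a *: u | a in I & u in N].

Definition ideal_exp_mul I (m : nat) : set M := iter m (ideal_mul I) setT.

End Submodules.

Arguments finitely_generated {S} M.

(* Local cohomology through the Cech complex.  The graded module is given by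
   its homogeneous pieces V g, sitting in an ambient R-module U; it need only be
   stable under the elements x_i, which are homogeneous of degree delta.  The
   term of cohomological degree j of the complex is the direct sum over the
   j-element sets T of the localizations at x_T = \prod_(t in T) x_t. *)
Section LocalCohomology.
Variables (R : comNzRingType) (U : lmodType R) (G : zmodType) (V : G -> set U).
Variables (delta : G) (r : nat) (x : 'I_r -> R).

Definition xprod (T : {set 'I_r}) : R := \prod_(t in T) x t.

(* u / y^a = v / y^b in the localization at y *)
Definition eq_frac (y : R) (u : U) (a : nat) (v : U) (b : nat) : Prop :=
  exists c : nat, y ^+ c *: (y ^+ b *: u - y ^+ a *: v) = 0.

(* A cochain of internal degree g is written with a common denominator: it is
   the family of the fractions p T / x_T^a.  The family runs over all T, but
   cohomological degree j only looks at the T with j elements. *)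
Definition cech_cochain (g : G) (a : nat) (p : {set 'I_r} -> U) : Prop :=
  forall T : {set 'I_r}, V (g + delta *+ (a * #|T|)) (p T).

(* Numerator, over x_T^a, of the component at T of the differential of p. *)
Definition cech_diff (a : nat) (p : {set 'I_r} -> U) (T : {set 'I_r}) : U :=
  \sum_(t in T)
    (-1) ^+ #|[set s in T | (s < t)%N]| *: (x t ^+ a *: p (T :\ t)%SET).

Definition cech_cocycle (j a : nat) (p : {set 'I_r} -> U) : Prop :=
  forall T : {set 'I_r}, #|T| = j.+1 -> eq_frac (xprod T) (cech_diff a p T) a 0 0.

Definition cech_coboundary (j : nat) (g : G) (a : nat) (p : {set 'I_r} -> U)
    : Prop :=
  exists (b : nat) (q : {set 'I_r} -> U), cech_cochain g b q /\
    forall T : {set 'I_r}, #|T| = j ->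
      eq_frac (xprod T) (p T) a (cech_diff b q T) b.

(* The component of degree g of H^j is nonzero. *)
Definition local_cohomology_neq0 (j : nat) (g : G) : Prop :=
  exists (a : nat) (p : {set 'I_r} -> U),
    [/\ cech_cochain g a p, cech_cocycle j a p & ~ cech_coboundary j g a p].

End LocalCohomology.

(* Least upper bound in the extended integers; -oo for the empty set. *)
Definition esup (A : set (\bar int)) : \bar int := supremum -oo%E A.

Definition reg (S : comNzRingType) (M : lmodType S) (r : nat) (x : 'I_r -> S)
    (V : int -> set M) : \bar int :=
  esup (range (fun j : nat =>
    (esup [set n%:E | n in local_cohomology_neq0 V 1 x j] + (j%:Z)%:E)%E)).

(* Power series in t with coefficients in M, as a module over S[t] by
   convolution; M[t] is the submodule of finitely supported sequences. *)
Definition tseries (S : comNzRingType) (M : lmodType S) : Type := nat -> M.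

Section TSeries.
Variables (S : comNzRingType) (M : lmodType S).

HB.instance Definition _ := GRing.Zmodule.copy (tseries M) (nat -> M).

Definition tscale (p : {poly S}) (u : tseries M) : tseries M :=
  fun n => \sum_(i < n.+1) p`_i *: u (n - i)%N.

Fact tscaleA p q u : tscale p (tscale q u) = tscale (p * q) u.
Proof.
apply/funext => n; rewrite /tscale.
pose F i j := (p`_i * q`_(j - i)) *: u (n - j)%N.
transitivity (\sum_(i < n.+1) \sum_(j < n.+1 | (i <= j)%N) F i j).
  apply: eq_bigr => -[i /= lei] _.
  transitivity (\sum_(i <= j < n.+1) F i j); last first.
    by rewrite big_geq_mkord; apply: eq_bigl => j.
  rewrite -[X in \sum_(X <= j < _) _]add0n big_addn subSn // big_mkord.
  rewrite scaler_sumr.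
  by apply: eq_bigr => j _; rewrite /F addnK scalerA -subnDA addnC.
rewrite (exchange_big_dep predT) //=; apply: eq_bigr => -[j /= lej] _.
rewrite ltnS in lej; rewrite (big_ord_narrow_leq lej) coefM scaler_suml.
by apply: eq_bigr.
Qed.

Fact tscale1 : left_id 1 tscale.
Proof.
move=> u; apply/funext => n; rewrite /tscale big_ord_recl /= coef1 scale1r subn0.
by rewrite big1 ?addr0 // => i _; rewrite coef1 scale0r.
Qed.

Fact tscaleDr : right_distributive tscale +%R.
Proof.
move=> p u v; apply/funext => n.
rewrite [RHS](_ : _ = tscale p u n + tscale p v n) // /tscale -big_split /=.
by apply: eq_bigr => i _; rewrite -scalerDr.
Qed.

Fact tscaleDl u : {morph tscale^~ u : p q / p + q}.
Proof.
move=> p q; apply/funext => n.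
rewrite [RHS](_ : _ = tscale p u n + tscale q u n) // /tscale -big_split /=.
by apply: eq_bigr => i _; rewrite coefD scalerDl.
Qed.

HB.instance Definition _ := GRing.Zmodule_isLmodule.Build {poly S} (tseries M)
  tscaleA tscale1 tscaleDr tscaleDl.

End TSeries.

(* The components of bidegree (i, n) of the Rees module R(I, M) in M[t]. *)
Section ReesModule.
Variables (S : comNzRingType) (M : lmodType S).
Variables (Mg : int -> set M) (I : set S) (d : nat).

Definition rees_module : set (tseries M) :=
  [set u | (forall n, ideal_exp_mul I n (u n)) /\
           exists N : nat, forall n, (N <= n)%N -> u n = 0].

(* (I^n M)_(n d + i) t^n, which is 0 for n < 0 *)
Definition rees_component (b : int * int) : set (tseries M) :=
  [set u | rees_module u /\
    forall l : nat, if l%:Z == b.2 then Mg ((l * d)%N%:Z + b.1) (u l)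
                    else u l = 0].

(* f is a family of forms spanning I_d *)
Definition reg_y (s : nat) (f : 'I_s -> S) : \bar int :=
  esup [set v | exists (i n : int) (j : nat), v = (n + j%:Z)%:E /\
    local_cohomology_neq0 rees_component (0, 1) (fun l => (f l)%:P * 'X)
      j (i, n)].

End ReesModule.

(* Main.v *)
Require Import Defs.
From mathcomp Require Import all_boot all_order all_algebra.
From mathcomp Require Import boolp classical_sets functions constructive_ereal.
From mathcomp Require Import zify ring.
Set Implicit Arguments.
Unset Strict Implicit.
Unset Printing Implicit Defensive.
Import Order.TTheory GRing.Theory Num.Theory.
Local Open Scope classical_set_scope.
Local Open Scope ring_scope.

(* Write F(n, i) for M_(nd+i) = (I^n M)_(nd+i), i >= 0.  As M / I^n M has finite
   length, I^n M and M have the same local cohomology except in cohomological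
   degrees 0 and 1; once nd > reg M this gives reg I^n M <= nd + i <-> F(n, i).
   So reg I^n M - nd, which is nonnegative since I^n M lives in degrees >= nd,
   is constant from m on as soon as F(n, i) does not depend on n >= m.
   - F(n, i) -> F(n+1, i) for n > 0: M_(nd+i) lies in IM, hence so does M in
     all higher degrees, and M_((n+1)d+i) = I_d M_(nd+i).
   - F(n+1, i) -> F(n, i) for n >= reg_y: if v is in M_(nd+i), then
     I_d v t^(n+1) lies in the Rees module, so v defines a class of degree (i, n)
     in its H^1, which vanishes.  Hence v - w is killed by powers of I_d for
     some w in I^n M, and then by powers of S_+, so it is 0 as nd > reg M. *)

(** * Čech cochains over a common denominator *)

Section CechComplex.
Variables (R : comNzRingType) (U : lmodType R) (r : nat) (x : 'I_r -> R).
Implicit Types (p q : {set 'I_r} -> U) (T Y : {set 'I_r}).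

Definition insertion_sign (t : 'I_r) (T : {set 'I_r}) : R :=
  (-1) ^+ #|[set s in T | (s < t)%N]%SET|.

Lemma insertion_signU1 (t s : 'I_r) T : s \notin T ->
  insertion_sign t (s |: T)%SET
  = (if (s < t)%N then -1 else 1) * insertion_sign t T.
Proof.
move=> sT; rewrite /insertion_sign; case: ifP => st.
  rewrite -exprS; congr (_ ^+ _).
  rewrite (_ : [set s0 in _ | _]%SET = s |: [set s0 in T | (s0 < t)%N])%SET.
    by rewrite cardsU1 !inE (negbTE sT).
  by apply/setP => z; rewrite !inE; case: eqVneq => [->|//]; rewrite st.
rewrite mul1r; congr (_ ^+ #|pred_of_set _|).
by apply/setP => z; rewrite !inE; case: eqVneq => [->|//]; rewrite st !andbF.
Qed.

Lemma insertion_sign_setU1 t T : insertion_sign t (t |: T)%SET = insertion_sign t T.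
Proof.
congr (_ ^+ #|pred_of_set _|); apply/setP => z; rewrite !inE.
by case: eqVneq => [->|//]; rewrite ltnn !andbF.
Qed.

Lemma xprod0 : xprod x finset.set0 = 1. Proof. by rewrite /xprod big_set0. Qed.

Lemma xprod1 t : xprod x [set t]%SET = x t. Proof. by rewrite /xprod big_set1. Qed.

Lemma xprodD1 t T : t \in T -> xprod x T = x t * xprod x (T :\ t)%SET.
Proof. by move=> tT; rewrite /xprod (big_setD1 t tT). Qed.

(** Since [x_T] is [x_t] times the product over [T :\ t], passing to a larger common denominator
    commutes with the differential. *)
Lemma cech_diff_raise a c p T : xprod x T ^+ c *: cech_diff x a p T
  = cech_diff x (a + c) (fun Y => xprod x Y ^+ c *: p Y) T.
Proof.
rewrite /cech_diff scaler_sumr; apply: eq_bigr => t tT.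
rewrite !scalerA (xprodD1 tT) exprMn exprD; congr (_ *: _).
by ring.
Qed.

Lemma eq_cech_diff a p q T :
  (forall t, t \in T -> p (T :\ t)%SET = q (T :\ t)%SET) ->
  cech_diff x a p T = cech_diff x a q T.
Proof. by move=> pq; apply: eq_bigr => t tT; rewrite pq. Qed.

Lemma cech_diff_set0 a p : cech_diff x a p finset.set0 = 0.
Proof. by rewrite /cech_diff big_set0. Qed.

Lemma cech_diff_set1 a p t : cech_diff x a p [set t]%SET = x t ^+ a *: p finset.set0.
Proof.
rewrite /cech_diff big_set1 finset.setDv (_ : [set s in _ | _]%SET = finset.set0).
  by rewrite cards0 scale1r.
by apply/setP => z; rewrite !inE; case: eqVneq => [->|//]; rewrite ltnn.
Qed.

(** This is [d (d v) = 0] for the 0-cochain [v]: at a pair the two terms agree up to opposite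
    signs. *)
Lemma cech_diff_set2 a (v : U) T : #|T| = 2 ->
  cech_diff x a (fun Y => xprod x Y ^+ a *: v) T = 0.
Proof.
move=> /eqP/cards2P[s [t [st ->]]].
wlog lt_st : s t st / (s < t)%N.
  move=> H; case: (ltngtP s t) => [|lt_ts|/val_inj/eqP].
  - exact: H.
  - by rewrite finset.setUC; apply: H => //; rewrite eq_sym.
  - by rewrite (negbTE st).
rewrite /cech_diff.
under eq_bigr => i iT do rewrite [x i ^+ a *: _]scalerA -exprMn -xprodD1 //.
rewrite -scaler_suml big_setU1 ?inE //= big_set1.
rewrite (_ : [set z : 'I_r in [set s; t] | (z < s)%N]%SET = finset.set0); last first.
  apply/setP => z; rewrite !inE; case: eqVneq => [->|_] /=; first by rewrite ltnn.
  by case: eqVneq => [->|//]; rewrite ltnNge ltnW.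
rewrite (_ : [set z : 'I_r in [set s; t] | (z < t)%N]%SET = [set s])%SET; last first.
  apply/setP => z; rewrite !inE; case: eqVneq => [->|_] /=; first by rewrite lt_st.
  by case: eqVneq => [->|//]; rewrite ltnn.
by rewrite cards0 cards1 expr0 expr1 addrN scale0r.
Qed.

Section Graded.
Variables (G : zmodType) (V : G -> set U) (delta : G).
Hypothesis xV : forall g u t, V g u -> V (g + delta) (x t *: u).


Lemma x_homog g u t c : V g u -> V (g + delta *+ c) (x t ^+ c *: u).
Proof.
move=> Vu; elim: c => [|c IH]; first by rewrite expr0 scale1r mulr0n addr0.
by rewrite exprS -scalerA mulrSr addrA; apply: xV.
Qed.

Lemma xprod_homog g u T c :
  V g u -> V (g + delta *+ (c * #|T|)) (xprod x T ^+ c *: u).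
Proof.
rewrite /xprod -big_enum cardE /=.
elim: (enum _) g u => [|t l IH] g u Vu.
  by rewrite big_nil expr1n scale1r muln0 mulr0n addr0.
rewrite big_cons exprMn mulrC -scalerA mulnS mulrnDr addrA.
exact/IH/x_homog.
Qed.

(** Vanishing of [H^j] in degree [g], with equations between numerators instead of fractions:
    cocycles hold exactly, boundaries after extending by [x_T^c]. *)
Definition cech_exact (j : nat) (g : G) : Prop :=
  forall a p, cech_cochain V delta g a p ->
    (forall T, #|T| = j.+1 -> cech_diff x a p T = 0) ->
  exists c q, cech_cochain V delta g (a + c) q /\
    forall T, #|T| = j -> xprod x T ^+ c *: p T = cech_diff x (a + c) q T.

Lemma cech_cochain_raise g a c p : cech_cochain V delta g a p ->
  cech_cochain V delta g (a + c) (fun T => xprod x T ^+ c *: p T).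
Proof. by move=> Vp T; rewrite mulnDl mulrnDr addrA; apply: xprod_homog. Qed.

(* There are finitely many T, so fractions that agree at each of the T of a
   given size become equal numerators over one common denominator. *)
Lemma eq_frac_uniform (P : pred {set 'I_r}) (y : {set 'I_r} -> R)
    (u v : {set 'I_r} -> U) a b :
  (forall T, P T -> eq_frac (y T) (u T) a (v T) b) ->
  exists c, forall T, P T ->
    y T ^+ c *: (y T ^+ b *: u T - y T ^+ a *: v T) = 0.
Proof.
move=> /= H.
have /choice[c Hc] : forall T, exists c, P T ->
    y T ^+ c *: (y T ^+ b *: u T - y T ^+ a *: v T) = 0.
  by move=> T; case: (boolP (P T)) => [/H[c]|_]; [exists c | exists 0%N].
exists (\max_T c T)%N => T PT.
by rewrite -(subnK (leq_bigmax T)) exprD -scalerA Hc // scaler0.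
Qed.

Lemma cech_exactP j g :
  cech_exact j g <-> ~ local_cohomology_neq0 V delta x j g.
Proof.
split=> [ex [a [p [Vp cyc ncob]]]|nH a p Vp cyc].
  apply: ncob.
  have [C HC] := @eq_frac_uniform (fun T => #|T| == j.+1) (xprod x)
    (cech_diff x a p) (fun=> 0) a 0 (fun T TP => cyc T (eqP TP)).
  have [|c [q [Vq Hq]]] := ex (a + C)%N _ (cech_cochain_raise C Vp).
    move=> T TP; rewrite -cech_diff_raise.
    by have := HC T (introT eqP TP); rewrite scaler0 subr0 expr0 scale1r.
  exists (a + C + c)%N, q; split=> // T TP; exists 0%N.
  rewrite expr0 scale1r -(Hq _ TP) !scalerA -!exprD.
  by rewrite addnAC subrr.
have {nH} [b [q [Vq Hq]]] : cech_coboundary V delta x j g a p.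
  apply: contrapT => ncob; apply: nH; exists a, p; split=> // T TP.
  by exists 0%N; rewrite cyc // expr0 scale1r !scaler0 subrr.
have [C HC] := @eq_frac_uniform (fun T => #|T| == j) (xprod x) p
    (cech_diff x b q) a b (fun T TP => Hq T (eqP TP)).
(* The equality [p / x^a = d q / x^b] holds for numerators after the factor [x^C]; extending [p] by
   [x^(C+b)] and [d q] by [x^(C+a)] gives both the exponent [a + b + C]. *)
exists (C + b)%N, (fun T => xprod x T ^+ (C + a) *: q T).
rewrite (_ : a + (C + b) = b + (C + a))%N; last lia.
split=> [|T TP]; first exact: cech_cochain_raise.
rewrite -cech_diff_raise !exprD -!scalerA; apply/eqP.
by rewrite -subr_eq0 -scalerBr HC ?TP.
Qed.

(** Placed at the empty set over a large exponent, a torsion element is a 0-cocycle, while a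
    0-coboundary is an empty sum. *)
Lemma H0_exact_eq0 g u : cech_exact 0 g -> (forall h, V h 0) -> V g u ->
  (forall t, exists c, x t ^+ c *: u = 0) -> u = 0.
Proof.
move=> ex V0 Vu /choice[c Hc].
pose C := (\max_t c t)%N.
have [||c' [q [_ /(_ _ (cards0 _))]]] :=
  ex C (fun T => if T == finset.set0 then u else 0).
- move=> T; case: eqVneq => [->|//]; first by rewrite cards0 muln0 mulr0n addr0.
- move=> T /eqP/cards1P[t ->]; rewrite cech_diff_set1 eqxx.
  by rewrite -(subnK (leq_bigmax t : c t <= C)%N) exprD -scalerA Hc scaler0.
by rewrite eqxx xprod0 expr1n scale1r cech_diff_set0.
Qed.

(** The fractions [x_t^a v / x_t^a] form a 1-cocycle of [V] even when [v] is not in [V]; a 0-cochain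
    bounding it is the element [w]. *)
Lemma H1_exact_lift g a v : cech_exact 1 g -> (forall h, V h 0) ->
  (forall t, V (g + delta *+ a) (x t ^+ a *: v)) ->
  exists2 w, V g w & forall t, exists c, x t ^+ c *: (v - w) = 0.
Proof.
move=> ex V0 Vv.
have [||c [q [Vq Hq]]] := ex a
  (fun T => if #|T| == 1%N then xprod x T ^+ a *: v else 0).
- move=> T; case: ifP => // /cards1P[t ->].
  by rewrite cards1 muln1 xprod1.
- move=> T TP; rewrite -[RHS](cech_diff_set2 a v TP); apply: eq_cech_diff => t tT.
  by move: TP; rewrite (cardsD1 t T) tT add1n => -[->].
exists (q finset.set0) => [|t].
  by have := Vq finset.set0; rewrite cards0 muln0 mulr0n addr0.
exists (a + c)%N; have := Hq [set t]%SET (cards1 t).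
rewrite cards1 xprod1 cech_diff_set1 /= scalerA -exprD addnC => H.
by rewrite scalerBr H subrr.
Qed.

End Graded.
End CechComplex.

(** * The Čech-Koszul double complex *)

(** The terms at [(t, s)] and [(s, t)] cancel; the diagonal is a separate hypothesis because
    antisymmetry does not kill it in the presence of 2-torsion. *)
Lemma sum_antisymmetric (U : zmodType) n (F : 'I_n -> 'I_n -> U) :
  (forall t s, F t s = - F s t) -> (forall t, F t t = 0) ->
  \sum_t \sum_s F t s = 0.
Proof.
move=> Fanti Fdiag.
under eq_bigr => t _ do rewrite (bigID (fun s : 'I_n => (s < t)%N)) /=.
rewrite big_split /= addrC (exchange_big_dep predT) //= -big_split big1 //= => t _.
rewrite (bigD1 t) ?ltnn //= Fdiag add0r.
under eq_bigr => s _ do rewrite Fanti.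
rewrite sumrN [X in - X + _](eq_bigl (fun s : 'I_n => (s < t)%N)) ?addNr //.
by move=> s; rewrite -leqNgt ltn_neqAle andbC.
Qed.

Section Koszul.
Variables (R : comNzRingType) (U : lmodType R) (r : nat) (x : 'I_r -> R).
Implicit Types (T Y : {set 'I_r}).

(** The differential of the homological Koszul complex, written on coefficients. *)
Definition koszul_diff (p : {set 'I_r} -> U) T : U :=
  \sum_(t | t \notin T) insertion_sign R t T *: (x t *: p (t |: T)%SET).

Lemma koszul_diffB p q T :
  koszul_diff (fun Y => p Y - q Y) T = koszul_diff p T - koszul_diff q T.
Proof.
by rewrite -sumrB; apply: eq_bigr => t _; rewrite -!scalerBr.
Qed.

Lemma koszul_diffZ c p T :
  koszul_diff (fun Y => c *: p Y) T = c *: koszul_diff p T.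
Proof.
rewrite scaler_sumr; apply: eq_bigr => t _; rewrite !scalerA.
by congr (_ *: _); ring.
Qed.

Lemma eq_koszul_diff p q T : (forall Y, #|Y| = #|T|.+1 -> p Y = q Y) ->
  koszul_diff p T = koszul_diff q T.
Proof.
move=> pq; apply: eq_bigr => t tT; rewrite pq //.
by rewrite cardsU1 tT add1n.
Qed.

Lemma koszul_diff_diff p T : koszul_diff (koszul_diff p) T = 0.
Proof.
pose F t s := if [&& t \notin T, s \notin T & s != t] then
  (insertion_sign R t T * x t * (insertion_sign R s (t |: T)%SET * x s))
     *: p (s |: (t |: T))%SET else 0.
rewrite -[RHS](@sum_antisymmetric _ _ F).
- rewrite /koszul_diff big_mkcond; apply: eq_bigr => t _; rewrite /F.
  case: (boolP (t \in T)) => tT /=; first by rewrite big1.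
  rewrite !scaler_sumr big_mkcond; apply: eq_bigr => s _ /=.
  by rewrite !inE negb_or andbC; case: ifP => // _; rewrite !scalerA !mulrA.
- move=> t s; rewrite /F [in RHS]eq_sym [in RHS]andbCA.
  case: ifP; last by rewrite oppr0.
  move=> /and3P[tT sT st]; rewrite finset.setUCA -scaleNr; congr (_ *: _).
  rewrite !insertion_signU1 //.
  case: (ltngtP t s) => [_|_|/val_inj ts]; [ring|ring|].
  by rewrite ts eqxx in st.
- by move=> t; rewrite /F eqxx !andbF.
Qed.

Lemma cech_diffB a p q T :
  cech_diff x a (fun Y => p Y - q Y) T = cech_diff x a p T - cech_diff x a q T :> U.
Proof.
by rewrite -sumrB; apply: eq_bigr => t _; rewrite -!scalerBr.
Qed.

Lemma cech_koszul_comm a (F : {set 'I_r} -> {set 'I_r} -> U) Y T :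
  cech_diff x a (fun Y => koszul_diff (F Y) T) Y
  = koszul_diff (fun T => cech_diff x a (F^~ T) Y) T.
Proof.
rewrite /cech_diff /koszul_diff.
under eq_bigr => t _ do rewrite !scaler_sumr.
under [RHS]eq_bigr => t _ do rewrite !scaler_sumr.
rewrite exchange_big /=; apply: eq_bigr => s _; apply: eq_bigr => t _.
by rewrite !scalerA; congr (_ *: _); ring.
Qed.

(* The cochain with Koszul component T equal to u / x_T, supported at T, over
   the common denominator x_Y^(c+1): the Cech and the Koszul differentials
   agree on it. *)
Definition diagonal_chain (u : U) c Y T : U :=
  if Y == T then xprod x Y ^+ c *: u else 0.

(** A given [t] contributes to either side only when [Y] is the disjoint union of [t] and [T]; both
    terms are then [x_t^(c+1) x_T^c u] with the same sign. *)
Lemma cech_koszul_diagonal u c Y T :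
  cech_diff x c.+1 (fun Y => diagonal_chain u c Y T) Y
  = koszul_diff (diagonal_chain u c Y) T.
Proof.
rewrite /cech_diff /koszul_diff big_mkcond [RHS]big_mkcond /=.
apply: eq_bigr => t _; rewrite /diagonal_chain.
have [tY|tY] := boolP (t \in Y); last first.
  case: ifP => // _; case: eqVneq => [YT|]; last by rewrite !scaler0.
  by rewrite YT !inE eqxx in tY.
have [tT|tT] /= := boolP (t \in T).
  case: eqVneq => [YT|]; last by rewrite !scaler0.
  by rewrite -YT !inE eqxx in tT.
have -> : (Y :\ t == T)%SET = (Y == t |: T)%SET.
  apply/eqP/eqP => [<-|->]; first by rewrite finset.setD1K.
  by apply/finset.setP => z; rewrite !inE; case: eqVneq => [->|//]; rewrite (negbTE tT).
case: eqVneq => [YT|]; last by rewrite !scaler0.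
rewrite -[X in (-1) ^+ X]/(#|_|) -/(insertion_sign R t Y) YT insertion_sign_setU1.
rewrite finset.setU1K // (@xprodD1 _ _ _ t (t |: T)%SET) ?finset.setU11 //.
rewrite finset.setU1K // !scalerA exprMn exprS.
by congr (_ *: _); ring.
Qed.

Variables (V : int -> set U).
Hypothesis V0 : forall g, V g 0.
Hypothesis VB : forall g u v, V g u -> V g v -> V g (u - v).
Hypothesis xV : forall g u t, V g u -> V (g + 1) (x t *: u).

Lemma homog_sum g (J : Type) (l : seq J) (P : pred J) (F : J -> U) :
  (forall i, P i -> V g (F i)) -> V g (\sum_(i <- l | P i) F i).
Proof.
move=> VF; apply: big_rec => [//|i y Pi Vy].
by rewrite -[y]opprK -[- y]sub0r; apply: VB; [apply: VF|apply: VB].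
Qed.

Lemma homog_koszul_diff g (p : {set 'I_r} -> U) T :
  (forall Y, #|Y| = #|T|.+1 -> V g (p Y)) -> V (g + 1) (koszul_diff p T).
Proof.
move=> Vp; apply: homog_sum => t tT.
have Vt : V (g + 1) (x t *: p (t |: T)%SET).
  by apply/xV/Vp; rewrite cardsU1 tT.
rewrite /insertion_sign -signr_odd; case: (odd _); rewrite ?expr0 ?scale1r //.
by rewrite expr1 scaleN1r -sub0r; apply: VB.
Qed.

(* Zig-zag in the Cech-Koszul double complex, starting from u / x_T in each top
   corner and descending to Cech degree 0. *)
Lemma regularity_generation a u :
  (forall j : nat, cech_exact x V 1 j (a - j%:Z)) -> V a u ->
  exists v : 'I_r -> U, (forall t, V (a - 1) (v t)) /\ u = \sum_t x t *: v t.
Proof.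
move=> ex Vu.
(* Stage [n] treats the sets [T] of size [p = r - n]: [u / x_T] corrected by the Koszul boundary of
   [F] is a Čech cocycle of degree [p]. For [n = 0] take [F = 0], as no [Y] has [r + 1] elements. *)
have chain n : (n <= r)%N -> exists c (F : {set 'I_r} -> {set 'I_r} -> U),
    (forall T, #|T| = (r - n).+1 ->
       cech_cochain V 1 (a - (r - n).+1%:Z) c.+1 (F^~ T)) /\
    (forall Y T, #|T| = (r - n)%N -> #|Y| = (r - n).+1 ->
       cech_diff x c.+1 (fun Y => diagonal_chain u c Y T - koszul_diff (F Y) T) Y = 0).
  elim: n => [_|n IH lt_nr].
    exists 0%N, (fun _ _ => 0); rewrite subn0; split=> [T _ Y|Y T _ Yr]; first exact: V0.
    by have := max_card (mem Y); rewrite Yr card_ord ltnn.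
  have [c [F [VF cyc]]] := IH (ltnW lt_nr).
  have En : (r - n = (r - n.+1).+1)%N by lia.
  move: En VF cyc; move: (r - n.+1)%N => p -> VF cyc {IH}.
  pose z T Y := diagonal_chain u c Y T - koszul_diff (F Y) T.
  have Vz T : #|T| = p.+1 -> cech_cochain V 1 (a - p.+1%:Z) c.+1 (z T).
    move=> Tp Y; apply: VB.
      rewrite /diagonal_chain; case: eqVneq => [->|_]; last exact: V0.
      have := xprod_homog xV T c Vu.
      by rewrite Tp; congr (V _ _); lia.
    rewrite (_ : a - _ + _ = (a - p.+2%:Z + 1 *+ (c.+1 * #|Y|)) + 1); last lia.
    by apply: homog_koszul_diff => T' T'p; apply: VF; rewrite T'p Tp.
  (* Each cocycle [z T] is a boundary by exactness in degree [p + 1]; brought to one denominator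
     through [C], the bounding cochains form the next [F]. *)
  have /choice[Q HQ] : forall T, exists cq : nat * ({set 'I_r} -> U), #|T| = p.+1 ->
      cech_cochain V 1 (a - p.+1%:Z) (c.+1 + cq.1) cq.2 /\
      forall Y, #|Y| = p.+1 ->
        xprod x Y ^+ cq.1 *: z T Y = cech_diff x (c.+1 + cq.1) cq.2 Y.
    move=> T; have [Tp|/eqP Tp] := eqVneq #|T| p.+1; last by exists (0%N, fun=> 0).
    have [c' [q Hq]] := ex p.+1 _ _ (Vz T Tp) (fun Y => cyc Y T Tp).
    by exists (c', q).
  pose C := (\max_T (Q T).1)%N.
  pose G Y T := xprod x Y ^+ (C - (Q T).1) *: (Q T).2 Y.
  have EC T : (c.+1 + C = c.+1 + (Q T).1 + (C - (Q T).1))%N.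
    by rewrite -addnA subnKC // (leq_bigmax T).
  exists (c + C)%N, G; rewrite -addSn; split=> [T Tp|Y T Tp Yp].
    by rewrite (EC T); apply: cech_cochain_raise => //; case: (HQ T Tp).
  (* Commuting the differentials turns [d (koszul G)] into [koszul (d G)], that is [koszul z]. As
     [koszul (koszul F) = 0], this cancels [d] of the diagonal chain. *)
  rewrite cech_diffB addSn cech_koszul_diagonal cech_koszul_comm -addSn.
  rewrite (@eq_koszul_diff (fun T => cech_diff _ _ (G^~ T) Y)
    (fun T => xprod x Y ^+ C *: z T Y)); last first.
    move=> T'; rewrite Tp => T'p; rewrite (EC T') -cech_diff_raise.
    by rewrite -(HQ _ T'p).2 // scalerA -exprD subnK // (leq_bigmax T').
  rewrite -koszul_diffB (@eq_koszul_diff _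
    (fun T => xprod x Y ^+ C *: koszul_diff (F Y) T)).
    by rewrite koszul_diffZ koszul_diff_diff scaler0.
  move=> T' _; rewrite /z scalerBr opprB addrC /diagonal_chain.
  case: eqVneq => _; last by rewrite scaler0 subr0 addr0.
  by rewrite scalerA -exprD [(C + c)%N]addnC subrK.
have [c [F [VF cyc]]] := chain r (leqnn r); rewrite subnn in VF cyc.
exists (fun t => F finset.set0 [set t]%SET); split=> [t|].
  have := VF _ (cards1 t) finset.set0.
  by rewrite cards0 muln0 mulr0n addr0.
(* At Čech degree 0, [u] minus the Koszul boundary of [F] at the empty set is a 0-cocycle, hence
   zero; this boundary is the required sum. *)
have [||c' [q [_ /(_ _ (cards0 _))]]] :=
  ex 0%N c.+1 (fun Y => if Y == finset.set0
                        then u - koszul_diff (F Y) finset.set0 else 0).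
- move=> Y; case: eqVneq => [->|_]; last exact: V0.
  rewrite subr0 cards0 muln0 mulr0n addr0; apply: VB => //.
  rewrite -[a](subrK 1); apply: homog_koszul_diff => T; rewrite cards0 => T1.
  by have := VF T T1 finset.set0; rewrite cards0 muln0 mulr0n addr0.
- move=> Y Y1; rewrite -[RHS](cyc _ _ (cards0 _) Y1); apply: eq_cech_diff => t tY.
  have /eqP -> : (Y :\ t)%SET == finset.set0.
    by move: Y1; rewrite (cardsD1 t) tY add1n => -[/eqP]; rewrite cards_eq0.
  by rewrite eqxx /diagonal_chain eqxx xprod0 expr1n scale1r.
rewrite eqxx xprod0 expr1n scale1r cech_diff_set0 => /eqP.
rewrite subr_eq0 => /eqP ->; apply: eq_big => [t|t _]; rewrite ?inE // finset.setU0.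
rewrite /insertion_sign (_ : [set s in _ | _]%SET = finset.set0) ?cards0 ?scale1r //.
by apply/finset.setP => z; rewrite !inE.
Qed.

(** By [regularity_generation] an element of degree at least [a] is a combination of elements one
    degree lower; descending, everything comes from below [a], where [V] vanishes. *)
Lemma initial_degree_le_regularity a :
  (forall (j : nat) g, a <= g + j%:Z -> cech_exact x V 1 j g) ->
  (forall h u, h < a -> V h u -> u = 0) -> forall h u, V h u -> u = 0.
Proof.
move=> ex Va h u Vu; have [/Va|le_ah] := ltP h a; first exact.
rewrite -(subrK a h) in Vu.
have : 0 <= h - a by rewrite subr_ge0.
move: (h - a) Vu => [n|//]; elim/ltn_ind: n u => n IH u Vu _.
have [j|v [Vv ->]] := regularity_generation _ Vu.
  by apply: ex; lia.
rewrite big1 // => t _; rewrite [v t](_ : _ = 0) ?scaler0 //.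
case: n IH Vu Vv => [|n] IH Vu Vv; first by apply: Va (Vv t); lia.
apply: (IH n) => //; have := Vv t; congr (V _ _); lia.
Qed.

(** Extending by [x_T^C] moves a bounding cochain of [V] into degrees where [V] and [W] agree,
    except at the empty set, where [x_T = 1]. That set occurs only for [j = 1], whence the extra
    hypothesis. *)
Lemma cech_exact_sub (W : int -> set U) n0 (j : nat) g :
  (forall g u t, W g u -> W (g + 1) (x t *: u)) -> (forall g, W g 0) ->
  (forall h, W h `<=` V h) -> (forall h, n0 <= h -> V h `<=` W h) ->
  (j = 1%N -> V g `<=` W g) ->
  cech_exact x V 1 j g -> cech_exact x W 1 j g.
Proof.
move=> xW W0 WV VW VWg ex a p Wp cyc.
have [c [q [Vq Hq]]] := ex a p (fun T => WV _ _ (Wp T)) cyc.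
pose C := `|n0 - g|%N.
exists (c + C)%N, (fun T => if #|T|.+1 == j then xprod x T ^+ C *: q T else 0).
split=> [T|T Tj].
  case: ifP => [/eqP Tj|_]; last exact: W0.
  have := cech_cochain_raise xV C Vq T; rewrite addnA.
  case: (posnP #|T|) => [T0|Tpos].
    by rewrite T0 in Tj *; rewrite muln0 mulr0n addr0; apply: VWg; rewrite -Tj.
  apply: VW; have : (C <= (a + c + C) * #|T|)%N.
    by rewrite -[X in (X <= _)%N]muln1 leq_mul // leq_addl.
  by rewrite /C; lia.
rewrite addnA exprD mulrC -scalerA (Hq _ Tj) cech_diff_raise.
apply: eq_cech_diff => t tT.
by move: Tj; rewrite (cardsD1 t) tT add1n => ->; rewrite eqxx.
Qed.

End Koszul.

(** * Homogeneous components, spans and the determinant trick *)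

Section DirectSum.
Variables (J : choiceType) (V : zmodType) (W : J -> set V).
Hypothesis dsW : direct_sum_decomposition W.

Let W0 j : W j 0. Proof. by case: dsW => /(_ j)[]. Qed.
Let WB j u v : W j u -> W j v -> W j (u - v).
Proof. by case: dsW => /(_ j)[_ /(_ u v)]. Qed.
Let WD j u v : W j u -> W j v -> W j (u + v).
Proof. by move=> Wu Wv; rewrite -[v]opprK -[- v]sub0r; apply/WB/WB. Qed.

Let decomposes (v : V) (c : J -> V) := (forall j, W j (c j)) /\
  exists2 s : seq J, uniq s /\ (forall j, j \notin s -> c j = 0) & v = \sum_(j <- s) c j.

Let decomposes_ex v : exists c, decomposes v c.
Proof.
case: (dsW) => _ /(_ v)[s [c [Wc ->]]] _.
exists (fun j => \sum_(i <- s | i == j) c j); split.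
  by move=> j; apply: big_ind => // *; apply: WD.
exists (undup s).
  split=> [|j]; first exact: undup_uniq.
  rewrite mem_undup => js; rewrite big_seq_cond big_pred0 // => i.
  by apply/negP => /andP[si /eqP ij]; rewrite -ij si in js.
rewrite (exchange_big_dep predT) //= !big_seq; apply: eq_bigr => i si.
under eq_bigl do rewrite eq_sym.
by rewrite -big_filter filter_pred1_uniq ?undup_uniq ?mem_undup // big_seq1.
Qed.

Let sum_widen (s s' : seq J) (c : J -> V) : uniq s -> uniq s' -> {subset s <= s'} ->
  (forall j, j \notin s -> c j = 0) -> \sum_(j <- s) c j = \sum_(j <- s') c j.
Proof.
move=> us us' ss' c0; rewrite [RHS](bigID (mem s)) /= [X in _ + X]big1 // addr0.
rewrite -[RHS]big_filter; apply: perm_big; apply: uniq_perm => //.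
  exact: filter_uniq.
by move=> j; rewrite mem_filter /=; have [/ss'->|] := boolP (j \in s).
Qed.

Let decomposesB u v c c' : decomposes u c -> decomposes v c' ->
  decomposes (u - v) (fun j => c j - c' j).
Proof.
move=> [Wc [s [us c0] ->]] [Wc' [s' [us' c'0] ->]]; split=> [j|]; first exact: WB.
exists (undup (s ++ s')).
  split=> [|j]; first exact: undup_uniq.
  by rewrite mem_undup mem_cat negb_or => /andP[/c0 -> /c'0 ->]; rewrite subrr.
rewrite sumrB; congr (_ - _); apply: sum_widen => //; try exact: undup_uniq.
  by move=> j js; rewrite mem_undup mem_cat js.
by move=> j js; rewrite mem_undup mem_cat js orbT.
Qed.

Let decomposes0 c : decomposes 0 c -> forall j, c j = 0.
Proof.
move=> [Wc [s [us c0] /esym sum0]] j; have [js|/c0//] := boolP (j \in s).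
by case: dsW => _ _ /(_ s c us Wc sum0 j js).
Qed.

(** Uniqueness of the decomposition makes the chosen components additive. *)
Lemma direct_sum_projections : exists pi : J -> V -> V,
  [/\ forall j v, W j (pi j v), forall j u v, pi j (u - v) = pi j u - pi j v,
      forall i j v, W i v -> pi j v = if i == j then v else 0
    & forall v, exists s : seq J, v = \sum_(j <- s) pi j v].
Proof.
have [c Hc] := choice decomposes_ex.
have uniq_c v c' : decomposes v c' -> c v = c'.
  move=> /(decomposesB (Hc v)); rewrite subrr => /decomposes0 H.
  by apply/funext => j; apply/eqP; rewrite -subr_eq0 H.
exists (fun j v => c v j); split=> [j v|j u v|i j v Wv|v].
- by case: (Hc v).
- by rewrite (uniq_c _ _ (decomposesB (Hc u) (Hc v))).
- rewrite (uniq_c _ (fun j => if i == j then v else 0)) //; split=> [l|].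
    by case: eqVneq => [<-|].
  exists [:: i]; last by rewrite big_seq1 eqxx.
  by split=> // l; rewrite inE eq_sym => /negbTE ->.
- by have [_ [s _ e]] := Hc v; exists s.
Qed.

End DirectSum.

Section Spans.
Variables (S : comNzRingType) (M : lmodType S).

Lemma mspan_min (X P : set M) : P 0 -> (forall u v, P u -> P v -> P (u + v)) ->
  (forall a u, P u -> P (a *: u)) -> X `<=` P -> mspan X `<=` P.
Proof.
move=> P0 PD PZ XP _ [n [a [u [Xu ->]]]].
by apply: big_ind => // i _; apply/PZ/XP.
Qed.

Lemma mspan_range n (u : 'I_n -> M) v :
  mspan (range u) v -> exists b : 'I_n -> S, v = \sum_i b i *: u i.
Proof.
suff: mspan (range u) `<=` [set v | exists b : 'I_n -> S, v = \sum_i b i *: u i] by exact.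
apply: mspan_min => {v}.
- by exists (fun=> 0); rewrite big1 // => i _; rewrite scale0r.
- move=> _ _ [b ->] [c ->]; exists (fun i => b i + c i).
  by rewrite -big_split; apply: eq_bigr => i _; rewrite scalerDl.
- move=> a _ [b ->]; exists (fun i => a * b i).
  by rewrite scaler_sumr; apply: eq_bigr => i _; rewrite scalerA.
- move=> _ [i _ <-]; exists (fun j => (i == j)%:R).
  rewrite (bigD1 i) //= eqxx scale1r big1 ?addr0 // => j.
  by rewrite eq_sym => /negbTE ->; rewrite scale0r.
Qed.

Lemma mem_mspan (X : set M) u : X u -> mspan X u.
Proof.
move=> Xu; exists 1%N, (fun=> 1), (fun=> u); split=> //.
by rewrite big_ord1 scale1r.
Qed.

End Spans.

Section NilpotentAction.
Variables (S : comNzRingType) (M : lmodType S) (w : M).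

Definition nilpotent_on (a : S) : Prop := exists c : nat, a ^+ c *: w = 0.

Lemma nilpotent_onM a b : nilpotent_on b -> nilpotent_on (a * b).
Proof. by case=> c Hc; exists c; rewrite exprMn -scalerA Hc scaler0. Qed.

Lemma nilpotent_onD a b : nilpotent_on a -> nilpotent_on b -> nilpotent_on (a + b).
Proof.
move=> [m Hm] [n Hn]; exists (m + n)%N; rewrite exprDn scaler_suml big1 // => i _.
rewrite -mulr_natr mulrC -scalerA; have [le_ni|lt_in] := leqP n i.
  by rewrite -(subnK le_ni) exprD mulrA -scalerA Hn !scaler0.
rewrite (_ : m + n - i = (n - i) + m)%N; last lia.
by rewrite exprD -mulrA mulrCA mulrC -scalerA -scalerA [_ *: w]Hm !scaler0.
Qed.

End NilpotentAction.

(* Determinant trick: y acts on the generators of M by a matrix A with entries in I, so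
   det (y - A) kills M, and it is congruent to a power of y modulo I. *)
Lemma power_mem_ideal_annihilator (S : comNzRingType) (M : lmodType S) (I : set S)
    (y : S) :
  I 0 -> (forall a b, I a -> I b -> I (a + b)) -> (forall a b, I b -> I (a * b)) ->
  finitely_generated M ->
  (forall v : M, ideal_mul I setT (y *: v)) ->
  exists n b, I b /\ forall v : M, (y ^+ n - b) *: v = 0.
Proof.
move=> I0 ID IM [n [u uT]] yI.
have IB a b : I a -> I b -> I (a - b).
  by move=> Ia Ib; rewrite -mulN1r; apply/ID/IM.
have /choice[a Ha] : forall i, exists a : 'I_n -> S,
    (forall j, I (a j)) /\ y *: u i = \sum_j a j *: u j.
  move=> i; move: (yI (u i)).
  suff: ideal_mul I setT `<=` [set v | exists a : 'I_n -> S,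
    (forall j, I (a j)) /\ v = \sum_j a j *: u j] by exact.
  apply: mspan_min => [|v1 v2|b v|].
  - by exists (fun=> 0); split=> //; rewrite big1 // => j _; rewrite scale0r.
  - move=> [b [Ib ->]] [c [Ic ->]]; exists (fun j => b j + c j); split=> [j|].
      exact: ID.
    by rewrite -big_split; apply: eq_bigr => j _; rewrite scalerDl.
  - move=> [c [Ic ->]]; exists (fun j => b * c j); split=> [j|]; first exact: IM.
    by rewrite scaler_sumr; apply: eq_bigr => j _; rewrite scalerA.
  - move=> _ [b Ib [v _ <-]].
    have [|c ->] := @mspan_range _ _ _ u v; first by rewrite uT.
    exists (fun j => c j * b); split=> [j|]; first exact: IM.
    by rewrite scaler_sumr; apply: eq_bigr => j _; rewrite scalerA mulrC.
pose B : 'M[S]_n := y%:M - \matrix_(i, j) a i j.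
have detB : I (y ^+ n - \det B).
  rewrite -det_scalar.
  (* Congruence modulo [I] respects sums and products, so the entrywise congruence of [B] and [y%:M]
     passes to their determinants. *)
  pose eqI b c := I (b - c).
  have eqID b b' c c' : eqI b b' -> eqI c c' -> eqI (b + c) (b' + c').
    by move=> H1 H2; rewrite /eqI opprD addrACA; apply: ID.
  have eqIM b b' c c' : eqI b b' -> eqI c c' -> eqI (b * c) (b' * c').
    move=> H1 H2; rewrite /eqI.
    rewrite (_ : _ - _ = c * (b - b') + b' * (c - c')); last by ring.
    by apply: ID; apply: IM.
  have eqIxx b : eqI b b by rewrite /eqI subrr.
  rewrite -/(eqI _ _) /determinant; apply: (big_ind2 eqI) => [//|*|s _].
    exact: eqID.
  apply: (eqIM) => //; apply: (big_ind2 eqI) => [//|*|i _]; first exact: eqIM.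
  by rewrite !mxE /eqI opprB addrC subrK; case: (Ha i).
exists n, (y ^+ n - \det B); split=> // v; rewrite opprB addrC subrK.
have [|b ->] := @mspan_range _ _ _ u v; first by rewrite uT.
rewrite scaler_sumr big1 // => l _; rewrite scalerA mulrC -scalerA.
suff -> : \det B *: u l = 0 by rewrite scaler0.
have Bu i : \sum_j B i j *: u j = 0.
  under eq_bigr => j _ do rewrite !mxE scalerBl.
  rewrite sumrB (bigD1 i) //= eqxx mulr1n big1 ?addr0; last first.
    by move=> j; rewrite eq_sym => /negbTE ->; rewrite mulr0n scale0r.
  by case: (Ha i) => _ ->; rewrite subrr.
(* The adjugate turns [B] into the scalar matrix of [\det B], while [B] annihilates the column of
   generators. *)
transitivity (\sum_j (\adj B *m B) l j *: u j).
  rewrite mul_adj_mx (bigD1 l) //= mxE eqxx mulr1n big1 ?addr0 // => j.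
  by rewrite eq_sym mxE => /negbTE ->; rewrite mulr0n scale0r.
under eq_bigr => j _ do rewrite mxE scaler_suml.
rewrite exchange_big big1 //= => i _.
under eq_bigr => j _ do rewrite -scalerA.
by rewrite -scaler_sumr Bu scaler0.
Qed.

(** * Regularity as a least upper bound *)

Section Esup.
Implicit Types (A : set (\bar int)).

(** Without an integer upper bound the supremum is [+oo]; with a bound [N] but no integer in [A] it
    is [-oo]; otherwise it is the element of [A] at least distance below [N]. *)
Lemma esup_is_supremum A : A !=set0 -> supremums A (esup A).
Proof.
move=> A0; rewrite /esup /supremum ifF; last exact/negbTE/set0P.
suff [y Ay] : supremums A !=set0 by case: xgetP => // /(_ y Ay).
have [[N AN]|] := pselect (exists N : int, ubound A N%:E); last first.
  move=> H; exists +oo%E; split=> [y _|y Hy]; first exact: leey.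
  case: y Hy => [z Hz| //| Hz]; first by case: H; exists z.
  by case: H; exists 0 => z /Hz; rewrite leeNy_eq => /eqP ->.
have [[z0 Az0]|nA] := pselect (exists z : int, A z%:E); last first.
  exists -oo%E; split=> [z Az|z _]; last exact: leNye.
  case: z Az => [z Az|Az|//]; first by case: nA; exists z.
  by have := AN _ Az.
have exn : exists n : nat, `[< A (N - n%:Z)%:E >].
  have := AN _ Az0; rewrite lee_fin => le_z0.
  by exists `|N - z0|%N; apply/asboolP; rewrite gez0_abs ?subr_ge0 // subKr.
have [n /asboolP An nmin] := ex_minnP exn.
exists (N - n%:Z)%:E; split=> [z Az|z]; last exact.
case: z Az => [z Az|Az|_]; last exact: leNye; last by have := AN _ Az.
have := AN _ Az; rewrite !lee_fin => le_z.
have := nmin `|N - z|%N; rewrite gez0_abs ?subr_ge0 // subKr.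
by move=> /(_ (asboolT Az)); lia.
Qed.

Lemma esup_leP A y : (esup A <= y)%E <-> (forall a, A a -> a <= y)%E.
Proof.
have [->|/set0P A0] := eqVneq A set0.
  by rewrite /esup supremum0; split=> // _; apply: leNye.
have [ub lub] := esup_is_supremum A0; split=> [le a /ub|]; last exact: lub.
by move=> le_a; apply: le_trans le_a le.
Qed.

Lemma reg_leP (S : comNzRingType) (M : lmodType S) r (x : 'I_r -> S)
    (V : int -> set M) N :
  (reg x V <= N%:E)%E <->
  forall (j : nat) n, local_cohomology_neq0 V 1 x j n -> n + j%:Z <= N.
Proof.
rewrite /reg esup_leP; split=> [H j n Hjn|H _ [j _ <-]].
  have := H _ (ex_intro2 _ _ j I erefl).
  by rewrite -leeBrDr // => /esup_leP/(_ _ (ex_intro2 _ _ n Hjn erefl));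
    rewrite -EFinB lee_fin lerBrDr.
rewrite -leeBrDr //; apply/esup_leP => _ [n Hjn <-].
by rewrite -EFinB lee_fin lerBrDr; apply: H.
Qed.

Lemma reg_y_leP (S : comNzRingType) (M : lmodType S) (Mg : int -> set M)
    (I : set S) d s (f : 'I_s -> S) N :
  (reg_y Mg I d f <= N%:E)%E <->
  forall (i n : int) (j : nat),
    local_cohomology_neq0 (rees_component Mg I d) (0, 1) (fun l => (f l)%:P * 'X)
      j (i, n) -> n + j%:Z <= N.
Proof.
rewrite /reg_y esup_leP; split=> [H i n j Hj|H _ [i [n [j [-> Hj]]]]].
  by have := H _ (ex_intro _ i (ex_intro _ n (ex_intro _ j (conj erefl Hj))));
    rewrite lee_fin.
by rewrite lee_fin; apply: H Hj.
Qed.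

End Esup.

(** * Regularity of the modules I^m M *)

Lemma cech_exact0 (R : comNzRingType) (U : lmodType R) (G : zmodType) (V : G -> set U)
    (delta : G) r (x : 'I_r -> R) j g :
  (forall h u, V h u -> u = 0) -> cech_exact x V delta j g.
Proof.
move=> V0 a p Vp _; exists 0%N, p; rewrite addn0; split=> // T _.
rewrite (V0 _ _ (Vp T)) scaler0 /cech_diff big1 // => t _.
by rewrite (V0 _ _ (Vp _)) !scaler0.
Qed.

Section Powers.
Variables (k : fieldType) (S : comAlgType k) (Sg : nat -> set S).
Variables (r : nat) (x : 'I_r -> S) (hS : standard_graded Sg x).
Variables (d s : nat) (f : 'I_s -> S) (hf : forall i, Sg d (f i)).
Let I : set S := @mspan S S^o (range f).
Variables (M : lmodType S) (Mg : int -> set M) (hM : graded_module Sg Mg).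
Variables (q : int) (hgen : mspan (Mg q) = setT).

Lemma MgB j u v : Mg j u -> Mg j v -> Mg j (u - v).
Proof. by case: hM => -[/(_ j)[_ /(_ u v)]]. Qed.

Lemma Mg0 j : Mg j 0. Proof. by case: hM => -[/(_ j)[]]. Qed.

Lemma Mgx j u t : Mg j u -> Mg (j + 1) (x t *: u).
Proof. by move=> Mu; rewrite addrC; case: hM => _ /(_ 1%N); apply => //; case: hS. Qed.

Lemma Mgf j u l : Mg j u -> Mg (d%:Z + j) (f l *: u).
Proof. by case: hM => _; apply. Qed.

Lemma Mg_scalar j u c : Mg j u -> Mg j (c%:A *: u).
Proof.
move=> Mu; rewrite -[j]add0r; case: hM => _ /(_ 0%N); apply => //.
by case: hS => _ _ ->; exists c.
Qed.

(** The scalars preserving [P] form a subalgebra containing the [x_t], hence all of [S]. *)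
Lemma submodule_gen (P : set M) : P 0 -> (forall u v, P u -> P v -> P (u + v)) ->
  (forall c u, P u -> P (c%:A *: u)) -> (forall t u, P u -> P (x t *: u)) ->
  forall a u, P u -> P (a *: u).
Proof.
move=> P0 PD Pk Px a; case: hS => _ _ _ _.
move=> /(_ [pred a | `[< forall u, P u -> P (a *: u) >]]).
move=> H; suff /asboolP : a \in [pred a | `[< forall u, P u -> P (a *: u) >]] by [].
apply: H => [|t]; last by apply/asboolP => u; apply: Px.
split=> [|c b b' /asboolP Pb /asboolP Pb'|b b' /asboolP Pb /asboolP Pb'].
- by apply/asboolP => u; rewrite scale1r.
- apply/asboolP => u Pu; rewrite scalerDl -[c *: b]mulr_algl -scalerA.
  by apply: PD; [apply/Pk/Pb|apply: Pb'].
- by apply/asboolP => u Pu; rewrite -scalerA; apply/Pb/Pb'.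
Qed.

(** * Graded pieces of a module generated in degree [q] *)

Section Projections.
Variable pi : int -> M -> M.
Hypothesis piM : forall j v, Mg j (pi j v).
Hypothesis piB : forall j u v, pi j (u - v) = pi j u - pi j v.
Hypothesis piE : forall i j v, Mg i v -> pi j v = if i == j then v else 0.
Hypothesis pi_decomp : forall v, exists l : seq int, v = \sum_(j <- l) pi j v.

Let pi0 j : pi j 0 = 0. Proof. by have := piB j 0 0; rewrite !subrr. Qed.

Let piD j u v : pi j (u + v) = pi j u + pi j v.
Proof. by rewrite -{1}[v]opprK -{1}[- v]sub0r !piB pi0 sub0r opprK. Qed.

Let pi_id j v : Mg j v -> pi j v = v. Proof. by move/piE->; rewrite eqxx. Qed.

Let pi_bigsum j (J : Type) (l : seq J) (P : pred J) (F : J -> M) :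
  pi j (\sum_(i <- l | P i) F i) = \sum_(i <- l | P i) pi j (F i).
Proof. exact: (big_morph (pi j) (piD j) (pi0 j)). Qed.

Let pi_homog j j' a v : (forall i u, Mg i u -> Mg (j' + i) (a *: u)) ->
  pi (j' + j) (a *: v) = a *: pi j v.
Proof.
move=> aM; have [l El] := pi_decomp v.
transitivity (a *: pi j (\sum_(i <- l) pi i v)); last by rewrite -El.
rewrite {1}El scaler_sumr !pi_bigsum scaler_sumr; apply: eq_bigr => i _.
rewrite (piE _ (aM _ _ (piM i v))) (piE _ (piM i v)) (inj_eq (addrI j')).
by case: ifP; rewrite ?scaler0.
Qed.

Let pi_x j t v : pi (j + 1) (x t *: v) = x t *: pi j v.
Proof. by rewrite addrC; apply: pi_homog => i u Mu; rewrite addrC; apply: Mgx. Qed.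

Let pi_f j l v : pi (d%:Z + j) (f l *: v) = f l *: pi j v.
Proof. by apply: pi_homog => i u; apply: Mgf. Qed.

Let pi_scalar j c v : pi j (c%:A *: v) = c%:A *: pi j v.
Proof.
rewrite -[in LHS](add0r j); apply: pi_homog => i u; rewrite add0r; exact: Mg_scalar.
Qed.

Let Mgen_ind (P : set M) : P 0 -> (forall u v, P u -> P v -> P (u + v)) ->
  (forall c u, P u -> P (c%:A *: u)) -> (forall t u, P u -> P (x t *: u)) ->
  Mg q `<=` P -> forall u, P u.
Proof.
move=> P0 PD Pk Px Pq u; have : setT u by [].
rewrite -hgen; suff: mspan (Mg q) `<=` P by exact.
by apply: mspan_min => //; apply: submodule_gen.
Qed.

Lemma Mg_lt_eq0 j v : j < q -> Mg j v -> v = 0.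
Proof.
move=> ltjq Mv; rewrite -(pi_id Mv); move: j ltjq {Mv}.
(* Speaking of the components of arbitrary elements makes the property stable under sums, scalars
   and the [x_t], so that induction from [Mg q] applies. *)
pose P := [set u | forall j, j < q -> pi j u = 0].
suff: P v by [].
apply: Mgen_ind => [j _|u u' Pu Pu' j jq|c u Pu j jq|t u Pu j jq|u Mu j jq].
- exact: pi0.
- by rewrite piD Pu ?Pu' ?addr0.
- by rewrite pi_scalar Pu ?scaler0.
- by rewrite -(subrK 1 j) pi_x Pu ?scaler0 //; lia.
- by rewrite (piE _ Mu) gt_eqF.
Qed.

Lemma Mg_succ j v : q <= j -> Mg (j + 1) v ->
  exists2 w : 'I_r -> M, (forall t, Mg j (w t)) & v = \sum_t x t *: w t.
Proof.
move=> leqj Mv; rewrite -(pi_id Mv); move: j leqj {Mv}.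
pose P := [set u | forall j, q <= j ->
  exists2 w : 'I_r -> M, (forall t, Mg j (w t)) & pi (j + 1) u = \sum_t x t *: w t].
suff: P v by [].
apply: Mgen_ind => [j _|u u' Pu Pu' j jq|c u Pu j jq|t u Pu j jq|u Mu j jq].
- exists (fun=> 0) => [t|]; first exact: Mg0.
  by rewrite pi0 big1 // => t _; rewrite scaler0.
- have [w Mw Ew] := Pu j jq; have [w' Mw' Ew'] := Pu' j jq.
  exists (fun t => w t + w' t) => [t|].
    by rewrite -[w' t]opprK -[- w' t]sub0r; apply/MgB/MgB => //; apply: Mg0.
  by rewrite piD Ew Ew' -big_split; apply: eq_bigr => t _; rewrite scalerDr.
- have [w Mw Ew] := Pu j jq; exists (fun t => c%:A *: w t) => [t|].
    exact: Mg_scalar.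
  rewrite pi_scalar Ew scaler_sumr; apply: eq_bigr => t _.
  by rewrite !scalerA mulrC.
- exists (fun t' => if t' == t then pi j u else 0) => [t'|].
    by case: ifP => _; [apply: piM|apply: Mg0].
  rewrite pi_x (bigD1 t) //= eqxx big1 ?addr0 // => t' /negbTE ->.
  by rewrite scaler0.
- exists (fun=> 0) => [t|]; first exact: Mg0.
  rewrite (piE _ Mu) ifF; last by apply/negbTE; lia.
  by rewrite big1 // => t _; rewrite scaler0.
Qed.

(** * The submodules [I^m M] and their graded pieces *)

Local Notation W := (@ideal_exp_mul S M I).

Lemma ideal_mulE N : N 0 -> (forall u v, N u -> N v -> N (u + v)) ->
  (forall a u, N u -> N (a *: u)) -> @ideal_mul S M I N =
  [set v | exists2 w : 'I_s -> M, (forall l, N (w l)) & v = \sum_l f l *: w l].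
Proof.
move=> N0 ND NZ; apply/seteqP; split=> [|_ [w Nw ->]]; last first.
  exists s, (fun=> 1), (fun l => f l *: w l); split=> [l|].
    exists (f l); last by exists (w l).
    by apply: (@mem_mspan S S^o); exists l.
  by apply: eq_bigr => l _; rewrite scale1r.
apply: mspan_min.
- by exists (fun=> 0) => //; rewrite big1 // => l _; rewrite scaler0.
- move=> _ _ [w Nw ->] [w' Nw' ->].
  exists (fun l => w l + w' l) => [l|]; first exact: ND.
  by rewrite -big_split; apply: eq_bigr => l _; rewrite scalerDr.
- move=> a _ [w Nw ->]; exists (fun l => a *: w l) => [l|]; first exact: NZ.
  by rewrite scaler_sumr; apply: eq_bigr => l _; rewrite !scalerA mulrC.
- move=> _ [b /(@mspan_range S S^o)[c ->] [v Nv <-]].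
  exists (fun l => c l *: v) => [l|]; first exact: NZ.
  by rewrite scaler_suml; apply: eq_bigr => l _; rewrite scalerA mulrC.
Qed.

Lemma power_submodule m : [/\ W m 0, forall u v, W m u -> W m v -> W m (u + v)
  & forall a u, W m u -> W m (a *: u)].
Proof.
elim: m => [|m [W0 WD WZ]]; first by [].
rewrite [ideal_exp_mul _ _]/= ideal_mulE //.
split=> [|_ _ [w Ww ->] [w' Ww' ->]|a _ [w Ww ->]].
- by exists (fun=> 0) => //; rewrite big1 // => l _; rewrite scaler0.
- exists (fun l => w l + w' l) => [l|]; first exact: WD.
  by rewrite -big_split; apply: eq_bigr => l _; rewrite scalerDr.
- exists (fun l => a *: w l) => [l|]; first exact: WZ.
  by rewrite scaler_sumr; apply: eq_bigr => l _; rewrite !scalerA mulrC.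
Qed.

Lemma powerS m : W m.+1 =
  [set v | exists2 w : 'I_s -> M, (forall l, W m (w l)) & v = \sum_l f l *: w l].
Proof. by have [W0 WD WZ] := power_submodule m; rewrite -ideal_mulE. Qed.

Lemma power_f m l v : W m v -> W m.+1 (f l *: v).
Proof.
move=> Wv; rewrite powerS; exists (fun l' => if l' == l then v else 0) => [l'|].
  by case: ifP => // _; case: (power_submodule m).
by rewrite (bigD1 l) //= eqxx big1 ?addr0 // => l' /negbTE ->; rewrite scaler0.
Qed.

Lemma power_anti m n : (m <= n)%N -> W n `<=` W m.
Proof.
move=> /subnK <-; elim: (n - m)%N => [//|p IH] v; rewrite addSn powerS.
move=> [w Ww ->]; have [W0 WD WZ] := power_submodule m.
by apply: big_ind => // l _; apply/WZ/IH.
Qed.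

Lemma power_graded m j v : W m v -> W m (pi j v).
Proof.
elim: m j v => [//|m IH] j v; rewrite powerS => -[w Ww ->].
rewrite pi_bigsum; exists (fun l => pi (j - d%:Z) (w l)) => [l|]; first exact: IH.
by apply: eq_bigr => l _; rewrite -pi_f addrC subrK.
Qed.

(** Each [f l] has degree [d], so replacing the cofactors by their components of degree [j] leaves
    the sum unchanged. *)
Lemma powerS_homog m j v : W m.+1 v -> Mg (d%:Z + j) v ->
  exists2 w : 'I_s -> M, (forall l, W m (w l) /\ Mg j (w l)) & v = \sum_l f l *: w l.
Proof.
rewrite powerS => -[w Ww ->] Mv; exists (fun l => pi j (w l)) => [l|].
  by split; [apply: power_graded|apply: piM].
rewrite -[LHS](pi_id Mv) pi_bigsum; apply: eq_bigr => l _; exact: pi_f.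
Qed.

Lemma power_lt_eq0 m j v : j < (m * d)%N%:Z + q -> W m v -> Mg j v -> v = 0.
Proof.
elim: m j v => [|m IH] j v ltj Wv Mv; first by apply: Mg_lt_eq0 Mv; lia.
have [|w WMw ->] := @powerS_homog m (j - d%:Z) v Wv; first by rewrite addrC subrK.
rewrite big1 // => l _; have [Ww Mw] := WMw l.
by rewrite (IH _ _ _ Ww Mw) ?scaler0 //; lia.
Qed.

Lemma power_contains_up m j j' :
  q <= j -> j <= j' -> Mg j `<=` W m -> Mg j' `<=` W m.
Proof.
move=> leqj lejj'; rewrite -[j'](subrK j) [_ + j]addrC.
have : 0 <= j' - j by rewrite subr_ge0.
case: (j' - j) => [n _|//]; elim: n => [|n IH MW v]; first by rewrite addr0.
rewrite (_ : j + n.+1%:Z = (j + n%:Z) + 1); last lia.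
move=> /Mg_succ[|w Mw ->]; first lia.
have [W0 WD WZ] := power_submodule m.
by apply: big_ind => // t _; apply/WZ/IH.
Qed.

(** [C i] asks for components in [IM] below degree [q + l + 1 - i]. If no [Mg j] with [j >= q] lay
    in [IM], each step of [C] would be strict, [Mg (q + l - i)] giving new elements of [C i.+1], and
    the chain would exceed the bound [l]. *)
Lemma Mg_sub_ideal_mul : finite_length_quotient (@ideal_mul S M I setT) ->
  exists2 j, q <= j & Mg j `<=` W 1.
Proof.
move=> [l Hl]; apply: contrapT => nH.
have [W0 WD WZ] := power_submodule 1.
pose C i := [set v | forall j, j < q + l.+1%:Z - i%:Z -> W 1 (pi j v)].
have := Hl l.+1 C; rewrite ltnn => H; suff: false by []; apply: H => [i lei|i lti].
- split=> [|v Wv j _]; last exact: power_graded.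
  have C0 : C i 0 by move=> j _; rewrite pi0.
  have CD u v : C i u -> C i v -> C i (u + v).
    by move=> Cu Cv j ltj; rewrite piD; apply: WD; [apply: Cu|apply: Cv].
  split=> // a u v Cu Cv; apply: (CD) => //; move: a u Cu {v Cv}.
  apply: submodule_gen => // [c u Cu j ltj|t u Cu j ltj].
    by rewrite pi_scalar; apply/WZ/Cu.
  by rewrite -(subrK 1 j) pi_x; apply/WZ/Cu; lia.
- split=> [v Cv j ltj|CC]; first by apply: Cv; lia.
  apply: nH; exists (q + l.+1%:Z - i.+1%:Z); first lia.
  move=> v Mv; rewrite -(pi_id Mv); apply: CC; last lia.
  by move=> j ltj; rewrite (piE _ Mv) gt_eqF.
Qed.

(** In high degree [v] lies in [IM] with cofactors of degree [j - d], which are in [I^m M] by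
    induction. *)
Lemma Mg_sub_power m : finite_length_quotient (@ideal_mul S M I setT) ->
  exists n0, forall j, n0 <= j -> Mg j `<=` W m.
Proof.
move=> /Mg_sub_ideal_mul[j0 leqj0 MW]; elim: m => [|m [n0 IH]]; first by exists 0.
exists (Num.max j0 (n0 + d%:Z)) => j; rewrite ge_max => /andP[le1 le2] v Mv.
have W1v : W 1 v by apply: (power_contains_up leqj0 le1 MW).
have [|w WMw ->] := @powerS_homog 0 (j - d%:Z) v W1v; first by rewrite addrC subrK.
rewrite powerS; exists w => // l; have [_ Mw] := WMw l.
by apply: IH Mw; lia.
Qed.

(** A power of [x_t] carries [Mg q] into degree [j0], hence [M] into [IM]. By the determinant trick
    a further power acts on [M] as some [b] in [I], and [b] is nilpotent on [v] because each [f l]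
    is. *)
Lemma f_torsion_x_torsion (v : M) : finitely_generated M ->
  finite_length_quotient (@ideal_mul S M I setT) ->
  (forall l, exists c, f l ^+ c *: v = 0) -> forall t, exists c, x t ^+ c *: v = 0.
Proof.
move=> hfg /Mg_sub_ideal_mul[j0 leqj0 MW] fv t.
have [W0 WD WZ] := power_submodule 1.
pose c := `|j0 - q|%N.
have yW u : W 1 (x t ^+ c *: u).
  pose P := [set u | W 1 (x t ^+ c *: u)]; suff: P u by [].
  apply: Mgen_ind => [|u1 u2 P1 P2|b u1 P1|t' u1 P1|u1 Mu].
  - by rewrite /P /= scaler0.
  - by rewrite /P /= scalerDr; apply: WD.
  - by rewrite /P /= scalerA mulrC -scalerA; apply: WZ.
  - by rewrite /P /= scalerA mulrC -scalerA; apply: WZ.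
  - apply: MW; have := x_homog Mgx t c Mu; congr (Mg _ _); lia.
have [|||n [b [Ib Hb]]] := @power_mem_ideal_annihilator S M I (x t ^+ c) _ _ _ hfg yW.
- by exists 0%N, (fun=> 0), (fun=> 0); split=> [[]//|]; rewrite big_ord0.
- move=> b b' /(@mspan_range S S^o)[z ->] /(@mspan_range S S^o)[z' ->].
  exists s, (fun l => z l + z' l), f; split=> [l|]; first by exists l.
  by rewrite -big_split; apply: eq_bigr => l _; rewrite scalerDl.
- move=> b b' /(@mspan_range S S^o)[z ->].
  exists s, (fun l => b * z l), f; split=> [l|]; first by exists l.
  rewrite [LHS](_ : _ = b * \sum_l z l * f l) // mulr_sumr.
  by apply: eq_bigr => l _; exact: mulrA.
have [e He] : nilpotent_on v b.
  have [z ->] := @mspan_range S S^o _ _ _ Ib.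
  apply: big_ind => [|b1 b2|l _]; first by exists 1%N; rewrite expr1 scale0r.
    exact: nilpotent_onD.
  by apply: nilpotent_onM; apply: fv.
have yb i : (x t ^+ c) ^+ (n * i) *: v = b ^+ i *: v.
  elim: i => [|i IH]; first by rewrite muln0.
  rewrite mulnS exprD -scalerA IH exprS -[RHS]scalerA; apply/eqP.
  by rewrite -subr_eq0 -scalerBl Hb.
by exists (c * (n * e))%N; rewrite exprM yb.
Qed.

(** * Initial degree and growth of [I^m M] *)

Definition power_component m (j : int) : set M := W m `&` Mg j.

Lemma power_component_x m j u t :
  power_component m j u -> power_component m (j + 1) (x t *: u).
Proof.
by move=> [Wu Mu]; split; [case: (power_submodule m) => _ _; apply|apply: Mgx].
Qed.

Lemma power_component0 m j : power_component m j 0.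
Proof. by split; [case: (power_submodule m)|apply: Mg0]. Qed.

Lemma power_componentB m j u v : power_component m j u -> power_component m j v ->
  power_component m j (u - v).
Proof.
move=> [Wu Mu] [Wv Mv]; split; last exact: MgB.
have [_ WD WZ] := power_submodule m.
by rewrite -[v]scale1r -scaleNr; apply/WD/WZ.
Qed.

(** [I^m M] lives in degrees at least [m d + q], and the regularity of a nonzero module is at least
    its initial degree. *)
Lemma reg_power_ge m N : (reg x (power_component m) <= N%:E)%E ->
  N < (m * d)%N%:Z + q -> forall j v, power_component m j v -> v = 0.
Proof.
move=> /reg_leP regN ltN; apply: (@initial_degree_le_regularity _ _ _ x
  (power_component m) (@power_component0 m) (@power_componentB m)
  (@power_component_x m) ((m * d)%N%:Z + q)).
  move=> j g leg; apply/cech_exactP => [|/regN]; last lia.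
  exact: power_component_x.
by move=> h v lth [Wv Mv]; apply: power_lt_eq0 lth Wv Mv.
Qed.

Lemma power_contains_succ m i : (0 < m)%N -> q <= (m * d)%N%:Z + i ->
  Mg ((m * d)%N%:Z + i) `<=` W m -> Mg ((m.+1 * d)%N%:Z + i) `<=` W m.+1.
Proof.
move=> m0 leq MW v Mv.
have W1v : W 1 v.
  apply: (power_contains_up leq _ _ Mv); first lia.
  by move=> u /MW; apply: power_anti.
have [|w WMw ->] := @powerS_homog 0 ((m * d)%N%:Z + i) v W1v.
  by move: Mv; congr (Mg _ _); lia.
by rewrite powerS; exists w => // l; apply/MW; case: (WMw l).
Qed.

(** * Multiplication by [f t] on the Rees module *)

Lemma tscaleCX (c : S) (u : tseries M) l :
  ((c%:P * 'X) *: u) l = if l is l'.+1 then c *: u l' else 0.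
Proof.
transitivity (\sum_(i < l.+1) (c%:P * 'X)`_i *: u (l - i)%N); first by [].
case: l => [|l].
  by rewrite big_ord_recl big_ord0 coefMX /= scale0r addr0.
rewrite big_ord_recl coefMX /= scale0r add0r big_ord_recl big1 ?addr0.
  by rewrite coefMX /= coefC /= subSS subn0.
by move=> i _; rewrite coefMX /= coefC /= scale0r.
Qed.

Lemma tscaleCXn (c : S) (u : tseries M) a l :
  ((c%:P * 'X) ^+ a *: u) (l + a)%N = c ^+ a *: u l.
Proof.
elim: a => [|a IH]; first by rewrite !expr0 !scale1r addn0.
by rewrite !exprS -scalerA addnS tscaleCX IH scalerA.
Qed.

Lemma rees_component_fX b u l : rees_component Mg I d b u ->
  rees_component Mg I d (b + (0, 1)) (((f l)%:P * 'X) *: u).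
Proof.
move=> [[Wu [N uN]] Mu]; split; first split.
- by move=> [|n]; rewrite tscaleCX //; apply: power_f.
- by exists N.+1 => -[//|n] leN; rewrite tscaleCX uN ?scaler0.
move=> [|n]; rewrite tscaleCX /=; first by case: ifP => // _; apply: Mg0.
have := Mu n; rewrite (_ : (n.+1%:Z == b.2 + 1) = (n%:Z == b.2)); last lia.
case: ifP => [_ Mun|_ ->]; last by rewrite scaler0.
by have := Mgf l Mun; congr (Mg _ _); lia.
Qed.

(** * Comparing the regularities of different powers *)

Section Regularity.
Hypothesis hfg : finitely_generated M.
Hypothesis hfl : finite_length_quotient (@ideal_mul S M I setT).
(** A strict upper bound for [reg M]; the theorem takes [D = m d]. *)
Variable D : int.
Hypothesis hD : forall (j : nat) g, D <= g + j%:Z -> cech_exact x Mg 1 j g.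

Let torsion_free g v : D <= g -> Mg g v -> (forall t, exists c, x t ^+ c *: v = 0) ->
  v = 0.
Proof.
move=> leD; apply: H0_exact_eq0; first by apply: hD; rewrite addr0.
exact: Mg0.
Qed.

(** Forward: high powers of the [x_t] push [v] in [M_g] into [I^m M], so by vanishing of [H^1] it
    differs from some [w] in [I^m M] by torsion, which is zero in degree [g]. Backward:
    [cech_exact_sub] transports vanishing from [M]; its case [j = 1] involves only degrees at least
    [g]. *)
Lemma reg_power_leP m i : D <= (m * d)%N%:Z + i -> q <= (m * d)%N%:Z + i ->
  (reg x (power_component m) <= ((m * d)%N%:Z + i)%:E)%E <->
  Mg ((m * d)%N%:Z + i) `<=` W m.
Proof.
set g := _ + i => leD leq; have [n0 Mn0] := Mg_sub_power m hfl.
split=> [/reg_leP regg v Mv|MW].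
  have ex1 : cech_exact x (power_component m) 1 1 g.
    by apply/cech_exactP => [|/regg]; [apply: power_component_x|lia].
  have [|t|w [Ww Mw] Hw] := @H1_exact_lift _ _ _ _ _ _ _ _ `|n0 - g|%N v ex1.
  - exact: power_component0.
  - have Mxv := x_homog Mgx t `|n0 - g|%N Mv.
    by split=> //; apply: Mn0 Mxv; lia.
  - suff : v - w = 0 by move/eqP; rewrite subr_eq0 => /eqP ->.
    by apply: torsion_free leD _ Hw; apply: MgB.
apply/reg_leP => j n Hjn; rewrite leNgt; apply/negP => ltg.
move: Hjn; apply/cech_exactP; first exact: power_component_x.
apply: (cech_exact_sub Mgx (n0 := n0)); last by apply: hD; lia.
- exact: power_component_x.
- exact: power_component0.
- by move=> h v [].
- by move=> h leh v Mv; split=> //; apply: Mn0 Mv.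
- move=> j1 v Mv; split=> //; apply: (power_contains_up leq _ MW Mv); lia.
Qed.

Lemma power_contains_pred n i : D <= (n * d)%N%:Z + i ->
  cech_exact (fun l => (f l)%:P * 'X) (rees_component Mg I d) (0, 1) 1 (i, n%:Z) ->
  Mg ((n.+1 * d)%N%:Z + i) `<=` W n.+1 -> Mg ((n * d)%N%:Z + i) `<=` W n.
Proof.
move=> leD ex1 MW v Mv.
(* This is [v t^n], possibly outside the Rees module; one factor [f l t] brings it inside. *)
pose tv : tseries M := fun l => if l == n then v else 0.
have [b|l|w [[Ww _] Mw] Hw] := @H1_exact_lift _ _ _ _ _ _ _ _ 1%N tv ex1.
- split; first split; last by move=> l; case: ifP => // _; apply: Mg0.
    by move=> l; case: (power_submodule l).
  by exists 0%N.
- have Mfv : Mg ((n.+1 * d)%N%:Z + i) (f l *: v).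
    by have := Mgf l Mv; congr (Mg _ _); lia.
  rewrite expr1 mulr1n; split; first split.
  + move=> [|p]; rewrite tscaleCX /tv; first by case: (power_submodule 0).
    case: eqVneq => [->|_]; first exact: MW.
    by rewrite scaler0; case: (power_submodule p.+1).
  + exists n.+2 => -[//|p] lep; rewrite tscaleCX /tv.
    by case: eqVneq => [pn|_]; rewrite ?scaler0 //; lia.
  + move=> [|p]; rewrite tscaleCX /tv /=; first by case: ifP => // _; apply: Mg0.
    rewrite (_ : (p.+1%:Z == n%:Z + 1) = (p == n)); last lia.
    case: eqVneq => [->|_]; last exact: scaler0.
    by move: Mfv; congr (Mg _ _); lia.
- suff : v - w n = 0 by move/eqP; rewrite subr_eq0 => /eqP ->.
  apply: torsion_free leD _ _.
    by apply: MgB => //; have := Mw n; rewrite eqxx.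
  (* The coefficient of [t^(n+c)] in the torsion relation shows that [f l ^+ c] kills [v - w n]. *)
  apply: f_torsion_x_torsion => // l; have [c Hc] := Hw l; exists c.
  have -> : v - w n = (tv - w) n by rewrite [RHS](_ : _ = tv n - w n) // /tv eqxx.
  by rewrite -tscaleCXn Hc.
Qed.

Lemma reg_power_stable m e : 0 <= q -> D <= (m * d)%N%:Z ->
  (forall (n : nat) i, (m <= n)%N ->
     cech_exact (fun l => (f l)%:P * 'X) (rees_component Mg I d) (0, 1) 1 (i, n%:Z)) ->
  (exists m0 : nat, forall n : nat, (m0 <= n)%N ->
     reg x (power_component n) = ((n * d)%N%:Z + e)%:E) ->
  reg x (power_component m) = ((m * d)%N%:Z + e)%:E.
Proof.
move=> q0 leD exy [m0 he].
(* If [I^n M] vanished, so would a later power, contradicting its finite regularity. *)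
have W_neq0 n : ~ forall j v, power_component n j v -> v = 0.
  move=> W0; pose p := maxn n m0.
  have : (reg x (power_component p) <= ((p * d)%N%:Z + e - 1)%:E)%E.
    apply/reg_leP => j g; apply: contraPP => _; apply/cech_exactP.
      exact: power_component_x.
    apply: cech_exact0 => h v [/(power_anti (leq_maxl n m0)) Wv Mv].
    exact: W0 (conj Wv Mv).
  by rewrite he ?leq_maxr // lee_fin; lia.
(* Otherwise all local cohomology of [M] vanishes in total degree at least the initial degree [q],
   and [M] is zero. *)
have ltqD : q < D.
  rewrite ltNge; apply/negP => leDq; apply: (W_neq0 0%N) => j v [_ Mv].
  apply: (initial_degree_le_regularity Mg0 MgB Mgx _ _ Mv (a := q)).
    by move=> i g leg; apply: hD; lia.
  by move=> h u; apply: Mg_lt_eq0.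
(* For [m = 0] the bound [D <= m d] would give [D <= 0 <= q]. *)
have m_gt0 : (0 < m)%N by case: (m) leD => [|//]; rewrite mul0n; lia.
have leD' n i : (m <= n)%N -> 0 <= i -> D <= (n * d)%N%:Z + i.
  by move=> lemn i0; have := leq_mul lemn (leqnn d); lia.
have Fiff n i : (m <= n)%N -> 0 <= i ->
    Mg ((n * d)%N%:Z + i) `<=` W n <-> Mg ((m * d)%N%:Z + i) `<=` W m.
  move=> /subnK <- i0; elim: (n - m)%N => [//|p [IH1 IH2]].
  have lemp : (m <= p + m)%N by rewrite leq_addl.
  have leDp := leD' _ _ lemp i0.
  split=> [Wp|/IH2 Wp].
    by apply: IH1; apply: power_contains_pred => //; apply: exy.
  by rewrite addSn; apply: power_contains_succ => //; lia.
have reg_leF n i : (m <= n)%N -> 0 <= i ->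
    (reg x (power_component n) <= ((n * d)%N%:Z + i)%:E)%E <->
    (reg x (power_component m) <= ((m * d)%N%:Z + i)%:E)%E.
  move=> lemn i0; have := leD' n i lemn i0; have := leD' m i (leqnn m) i0 => *.
  by rewrite !reg_power_leP ?Fiff //; lia.
pose p := maxn m m0; have lemp : (m <= p)%N := leq_maxl m m0.
have regp : reg x (power_component p) = ((p * d)%N%:Z + e)%:E.
  exact/he/leq_maxr.
(* Since [q >= 0], a negative [e] would put the regularity of [I^p M] below its initial degree. *)
have e0 : 0 <= e.
  rewrite leNgt; apply/negP => lte; apply: (W_neq0 p).
  by apply: (@reg_power_ge p ((p * d)%N%:Z + e)); [rewrite regp|lia].
apply/le_anti/andP; split; first by apply/(reg_leF p) => //; rewrite regp.
rewrite leNgt; apply/negP => ltm.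
have {ltm} lem : (reg x (power_component m) <= ((m * d)%N%:Z + (e - 1))%:E)%E.
  move: ltm; case: (reg _ _) => [c|//|_]; last exact: leNye.
  by rewrite lte_fin lee_fin; lia.
(* The bound [e - 1] transfers to [p] only if nonnegative; otherwise [e = 0], and the regularity of
   [I^m M] would be below its initial degree. *)
have [e1|lte] := leP 0 (e - 1).
  by move: lem; rewrite -(reg_leF p) // regp lee_fin; lia.
by apply: (W_neq0 m); apply: reg_power_ge lem _; lia.
Qed.

End Regularity.

End Projections.
End Powers.

Theorem corollary1p2 (k : fieldType) (S : comAlgType k) (Sg : nat -> set S)
    (r : nat) (x : 'I_r -> S) (hS : standard_graded Sg x)
    (I : set S) (d : nat) (hd : (0 < d)%N)
    (s : nat) (f : 'I_s -> S) (hf : forall i, Sg d (f i))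
    (hI : I = @mspan S S^o (range f))
    (M : lmodType S) (Mg : int -> set M) (hM : graded_module Sg Mg)
    (hfg : finitely_generated M)
    (q : int) (hq : 0 <= q) (hgen : mspan (Mg q) = setT)
    (hfl : finite_length_quotient (ideal_mul I (@setT M)))
    (e : int)
    (he : exists m0 : nat, forall m : nat, (m0 <= m)%N ->
      reg x (fun j => ideal_exp_mul I m `&` Mg j) = ((m * d)%N%:Z + e)%:E)
    (m : nat)
    (hm : (maxe (er_map (intr : int -> rat) (reg_y Mg I d f))
                ((er_map (intr : int -> rat) (reg x Mg) + 1) * (d%:R^-1)%:E)
           <= m%:R%:E)%E) :
  reg x (fun j => ideal_exp_mul I m `&` Mg j) = ((m * d)%N%:Z + e)%:E.
Proof.
move: hm; rewrite ge_max => /andP[hmy hmx]; subst I.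
have /reg_y_leP regy : (reg_y Mg (@mspan S S^o (range f)) d f <= (m%:Z)%:E)%E.
  move: hmy; case: (reg_y _ _ _ _) => [c|//|_] /=; last exact: leNye.
  by rewrite !lee_fin -(ler_int rat).
(* Clearing the denominator, [(reg M + 1) / d <= m] becomes [reg M <= m d - 1]; the value [+oo] is
   excluded as it survives division by [d > 0]. *)
have /reg_leP regM : (reg x Mg <= ((m * d)%N%:Z - 1)%:E)%E.
  have d0 : 0 < d%:R :> rat by rewrite ltr0n.
  move: hmx; case: (reg x Mg) => [c||_] /=; last exact: leNye.
    rewrite -EFinD -EFinM !lee_fin ler_pdivrMr // -natrM.
    by rewrite -[_ + 1]/(c%:~R + 1%:~R) -intrD pmulrn ler_int; lia.
  by rewrite addye // gt0_mulye ?lte_fin ?invr_gt0.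
have [pi [piM piB piE pi_decomp]] := direct_sum_projections hM.1.
apply: (reg_power_stable hS hf hM hgen piM piB piE pi_decomp hfg hfl
  (D := (m * d)%N%:Z)) => // [j g leg|n i lemn].
  apply/cech_exactP => [h u t|/regM]; last lia.
  exact: (Mgx hS hM).
(* In cohomological degree 1 the total degree is [n + 1 > m >= reg_y]. *)
apply/cech_exactP => [h u l|/regy]; last lia.
exact: (rees_component_fX hf hM).
Qed.
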